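(* Suppose the game has a unique Nash equilibrium $\boldsymbol{z}^*$. Then VOMWU with step size $0<\eta\le\frac{1}{8P}$ guarantees that, for some constant $C_2>0$ depending only on the game, $\widehat{\boldsymbol{z}}_1$ and $\eta$, for all $t\ge 1$, $$\frac12\|\widehat{\boldsymbol{z}}_t-\boldsymbol{z}^*\|^2\le D_{\Psi^{\mathrm{van}}}(\boldsymbol{z}^*,\widehat{\boldsymbol{z}}_t)\le\frac{C_2}{t}.$$
   Context: Treeplexes are defined recursively: (1) every probability simplex is a treeplex; (2) a Cartesian product of finitely many treeplexes is a treeplex; (3) given treeplexes $\mathcal{Z}_1\subset\mathbb{R}^{m}$, $\mathcal{Z}_2\subset\mathbb{R}^{n}$ and $i\in\{1,\dots,m\}$, the set $\{(\boldsymbol{u},u_i\cdot\boldsymbol{v})\in\mathbb{R}^{m+n}:\boldsymbol{u}\in\mathcal{Z}_1,\boldsymbol{v}\in\mathcal{Z}_2\}$ is a treeplex. Throughout, $\mathcal{X}\subset\mathbb{R}^M$ and $\mathcal{Y}\subset\mathbb{R}^N$ are treeplexes, $\boldsymbol{G}\in[-1,1]^{M\times N}$, $P=M+N$, $\mathcal{Z}=\mathcal{X}\times\mathcal{Y}\subset\mathbb{R}^P$, $\boldsymbol{z}=(\boldsymbol{x},\boldsymbol{y})$, and $F(\boldsymbol{z})=(\boldsymbol{G}\boldsymbol{y},-\boldsymbol{G}^\top\boldsymbol{x})$; it is assumed that $\|F(\boldsymbol{z})\|_\infty\le 1$ for all $\boldsymbol{z}\in\mathcal{Z}$. $\|\cdot\|$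 is the Euclidean norm. ''The game'' is $(\mathcal{X},\mathcal{Y},\boldsymbol{G})$. The set of Nash equilibria is $\mathcal{Z}^*=\mathcal{X}^*\times\mathcal{Y}^*$ with $\mathcal{X}^*=\arg\min_{\boldsymbol{x}\in\mathcal{X}}\max_{\boldsymbol{y}\in\mathcal{Y}}\boldsymbol{x}^\top\boldsymbol{G}\boldsymbol{y}$ and $\mathcal{Y}^*=\arg\max_{\boldsymbol{y}\in\mathcal{Y}}\min_{\boldsymbol{x}\in\mathcal{X}}\boldsymbol{x}^\top\boldsymbol{G}\boldsymbol{y}$. The vanilla entropy regularizer is $\Psi^{\mathrm{van}}(\boldsymbol{z})=\sum_i z_i\ln z_i$ (with $0\ln 0=0$), whose Bregman divergence is $D_{\Psi^{\mathrm{van}}}(\boldsymbol{z},\boldsymbol{z}')=\sum_i \big(z_i\ln(z_i/z_i')-z_i+z_i'\big)$. VOMWU is the following algorithm with $\psi=\Psi^{\mathrm{van}}$: starting from $\widehat{\boldsymbol{z}}_1=\boldsymbol{z}_0\in\mathcal{Z}$ with all entries positive, for $t=1,2,\dots$ $$\boldsymbol{z}_t=\arg\min_{\boldsymbol{z}\in\mathcal{Z}}\{\eta\langle\boldsymbol{z},F(\boldsymbol{z}_{t-1})\rangle+D_\psi(\boldsymbol{z},\widehat{\boldsymbol{z}}_t)\},\qquad \widehat{\boldsymbol{z}}_{t+1}=\arg\min_{\boldsymbol{z}\in\mathcal{Z}}\{\eta\langle\boldsymbol{z},F(\boldsymbol{z}_{t})\rangle+D_\psi(\boldsymbol{z},\widehat{\boldsymbol{z}}_t)\}.$$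 *)

(* Defs.v *)
From HB Require Import structures.
From mathcomp Require Import all_boot all_order all_algebra.
From mathcomp Require Import all_classical all_reals all_analysis.
Set Implicit Arguments.
Unset Strict Implicit.
Unset Printing Implicit Defensive.
Import Order.TTheory GRing.Theory Num.Theory.
Import numFieldNormedType.Exports.
Local Open Scope classical_set_scope.
Local Open Scope ring_scope.

(* Vectors of R^n are row vectors throughout. *)
Definition simplex (R : realType) (n : nat) : set 'rV[R]_n :=
  [set x | (forall i, 0 <= x 0 i) /\ \sum_i x 0 i = 1].

(* A set is a treeplex of R^n for the n in its type; two presentations whose
   dimensions are only provably equal (e.g. bracketings of a product) are
   identified by rewriting the index. *)
Inductive treeplex (R : realType) : forall n : nat, set 'rV[R]_n -> Prop :=
| treeplex_simplex (n : nat) :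
    treeplex (@simplex R n.+1)
| treeplex_prod (k : nat) (d : 'I_k.+1 -> nat)
    (Z : forall j, set 'rV[R]_(d j)) :
    (forall j, treeplex (Z j)) ->
    treeplex [set z : 'rV[R]_(\sum_j d j)%N | forall j, Z j (submxrow z j)]
| treeplex_branch (m n : nat) (Z1 : set 'rV[R]_m) (Z2 : set 'rV[R]_n)
    (i : 'I_m) :
    treeplex Z1 -> treeplex Z2 ->
    treeplex [set row_mx u (u 0 i *: v) | u in Z1 & v in Z2].

Definition argmin (R : realType) (T : Type) (A : set T) (f : T -> R) : set T :=
  [set x | A x /\ forall y, A y -> f x <= f y].

Definition argmax (R : realType) (T : Type) (A : set T) (f : T -> R) : set T :=
  [set x | A x /\ forall y, A y -> f y <= f x].

Definition dot (R : realType) (n : nat) (u v : 'rV[R]_n) : R :=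
  \sum_i u 0 i * v 0 i.

Definition enorm (R : realType) (n : nat) (v : 'rV[R]_n) : R :=
  Num.sqrt (dot v v).

Section Game.
Variables (R : realType) (M N : nat).
Variables (X : set 'rV[R]_M) (Y : set 'rV[R]_N) (G : 'M[R]_(M, N)).

Definition profiles : set 'rV[R]_(M + N) := [set row_mx x y | x in X & y in Y].

Definition F (z : 'rV[R]_(M + N)) : 'rV[R]_(M + N) :=
  row_mx (rsubmx z *m G^T) (- (lsubmx z *m G)).

Definition payoff (x : 'rV[R]_M) (y : 'rV[R]_N) : R := dot x (y *m G^T).

(* Treeplexes are nonempty and compact, so that [sup] and [inf] below are an
   attained maximum and minimum. *)
Definition minimax_set : set 'rV[R]_M :=
  argmin X (fun x => sup [set payoff x y | y in Y]).

Definition maximin_set : set 'rV[R]_N :=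
  argmax Y (fun y => inf [set payoff x y | x in X]).

Definition nash : set 'rV[R]_(M + N) :=
  [set row_mx x y | x in minimax_set & y in maximin_set].

End Game.

(* Bregman divergence of the vanilla entropy z |-> \sum_i z_i ln z_i, for z'
   with positive entries; [ln 0 = 0] gives the convention 0 ln 0 = 0. *)
Definition breg_van (R : realType) (n : nat) (z z' : 'rV[R]_n) : R :=
  \sum_i (z 0 i * ln (z 0 i / z' 0 i) - z 0 i + z' 0 i).

(* z and zh are the sequences z_0, z_1, ... and \hat z_1, \hat z_2, ...;
   the value zh 0 is irrelevant.  All iterates have positive entries since
   z1 does, so that [breg_van] is only used where it is meaningful. *)
Definition vomwu (R : realType) (M N : nat) (X : set 'rV[R]_M)
    (Y : set 'rV[R]_N) (G : 'M[R]_(M, N)) (eta : R) (z1 : 'rV[R]_(M + N))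
    (z zh : nat -> 'rV[R]_(M + N)) : Prop :=
  [/\ z 0%N = z1,
      zh 1%N = z1 &
      forall t : nat, (1 <= t)%N ->
        argmin (profiles X Y)
          (fun w => eta * dot w (F G (z t.-1)) + breg_van w (zh t)) (z t) /\
        argmin (profiles X Y)
          (fun w => eta * dot w (F G (z t)) + breg_van w (zh t)) (zh t.+1)].

(* Main.v *)
Require Import Defs.
From HB Require Import structures.
From mathcomp Require Import all_boot all_order all_algebra.
From mathcomp Require Import all_classical all_reals all_analysis.
From mathcomp Require Import ring lra.
Set Implicit Arguments.
Unset Strict Implicit.
Unset Printing Implicit Defensive.
Import Order.TTheory GRing.Theory Num.Theory.
Import numFieldNormedType.Exports.
Local Open Scope classical_set_scope.
Local Open Scope ring_scope.

(* The profile game is a symmetric zero-sum game on the polytope Z = X * Y with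
   payoff <w, F z> = w . (z S), S skew.  Tucker's theorem for skew matrices,
   applied to the vertices of Z, produces a strictly complementary equilibrium,
   which must be z* by uniqueness.  Strict complementarity and Farkas' lemma give
   an error bound: |z - z*| is at most a constant times the best gap
   <F z, z - w> over the vertices w of the face of z*.

   For the iterates, Theta_t = D(z*, zh_t) + D(zh_t, z_(t-1)) / 4 decreases by at
   least zeta_t / 2, where zeta_t = D(zh_(t+1), z_t) + D(z_t, zh_t).  Restricting
   the comparison points w to the face of z* makes the first-order condition
   usable although the coordinates off the support of z* may tend to 0, and the
   error bound yields Theta_(t+1) ^ 2 <= k (Theta_t - Theta_(t+1)), hence the
   rate 1 / t. *)

(** * Linear inequalities *)

(* Bartl's induction on the number of inequalities. *)
Lemma farkas (R : realFieldType) (m n : nat) (A : 'M[R]_(m, n)) (c : 'rV[R]_n) :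
  (forall x : 'cV[R]_n, (forall i, (A *m x) i 0 <= 0) -> (c *m x) 0 0 <= 0) ->
  exists2 l : 'rV[R]_m, (forall i, 0 <= l 0 i) & c = l *m A.
Proof.
elim: m A c => [|m IHm] A c Hc.
  (* With no inequalities, testing both signs of each basis vector forces [c = 0]. *)
  exists 0 => [[]//|]; rewrite mul0mx; apply/rowP => j; rewrite [RHS]mxE.
  have cj (s : R) : s * c 0 j <= 0.
    suff cs : (c *m (s *: delta_mx j 0 : 'cV[R]_n)) 0 0 <= 0.
      by move: cs; rewrite -scalemxAr -colE !mxE.
    by apply: Hc => -[].
  by have := cj 1; have := cj (- 1); rewrite mulN1r mul1r; lra.
move: A Hc; rewrite -[m.+1]/(1 + m)%N => A Hc.
pose a := usubmx A; pose B := dsubmx A.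
have defA : A = col_mx a B by rewrite vsubmxK.
have rowA (x : 'cV[R]_n) i : ((A *m x) i 0 : R) =
    match fintype.split i with inl _ => (a *m x) 0 0
    | inr j => (B *m x) j 0 end.
  by rewrite defA mul_col_mx mxE; case: (fintype.split _) => // k; rewrite ord1.
(* If the inequalities of [B] alone imply the conclusion, the row [a] gets multiplier 0. *)
have [IH1|] := pselect (forall x : 'cV[R]_n,
    (forall i, (B *m x) i 0 <= 0) -> (c *m x) 0 0 <= 0).
  have [l l0 ->] := IHm _ _ IH1.
  exists (row_mx 0 l) => [i|].
    by rewrite mxE; case: (fintype.split i) => // k; rewrite mxE.
  by rewrite defA mul_row_col mul0mx add0r.
move=> /existsNP [x0] /not_implyP [Bx0 /negP]; rewrite -ltNge => cx0.
have ax0 : 0 < (a *m x0) 0 0.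
  rewrite ltNge; apply/negP => ax0; move: cx0; rewrite ltNge => /negP; apply.
  by apply: Hc => i; rewrite rowA; case: (fintype.split _).
(* Otherwise a point with [B x <= 0] and [c x > 0] must violate [a]; it is scaled to [a x1 = 1]. The
   projection [x - x1 (a x)] makes [a] vanish, so the induction hypothesis applies to [B] and [c]
   precomposed with it. *)
pose x1 := ((a *m x0) 0 0)^-1 *: x0.
have ax1 : (a *m x1) 0 0 = 1 by rewrite -scalemxAr mxE mulVf ?gt_eqF.
have Bx1 i : (B *m x1) i 0 <= 0.
  by rewrite -scalemxAr mxE pmulr_rle0 ?invr_gt0.
have cx1 : 0 < (c *m x1) 0 0 by rewrite -scalemxAr mxE mulr_gt0 ?invr_gt0.
have [l l0 lE] : exists2 l : 'rV[R]_m, (forall i, 0 <= l 0 i)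
    & c - (c *m x1) *m a = l *m (B - (B *m x1) *m a).
  apply: IHm => x Hx.
  have -> : (c - c *m x1 *m a) *m x = c *m (x - x1 *m (a *m x)).
    by rewrite mulmxBl mulmxBr !mulmxA.
  apply: Hc => i; rewrite rowA; case: (fintype.split _) => [_|j].
    rewrite mulmxBr mulmxA [a *m x1]mx11_scalar ax1 mul1mx subrr mxE //.
  by have := Hx j; rewrite mulmxBl mulmxBr !mulmxA.
(* The multiplier of [a] is nonnegative because [c x1 > 0] and [B x1 <= 0]. *)
exists (row_mx ((c *m x1) - l *m (B *m x1)) l) => [i|].
  rewrite mxE; case: (fintype.split i) => // k; rewrite ord1.
  rewrite [X in _ <= X]mxE [X in _ + X]mxE subr_ge0 (le_trans _ (ltW cx1))//.
  rewrite mxE -oppr_ge0 -sumrN sumr_ge0// => j _.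
  by rewrite -mulrN mulr_ge0 ?oppr_ge0.
rewrite defA mul_row_col mulmxBl -!mulmxA.
by rewrite -[LHS](subrK (c *m x1 *m a)) lE mulmxBr !mulmxA addrC addrA [RHS]addrAC.
Qed.

(** For one index [i], Farkas' lemma leaves two cases. Either some [x >= 0] with [K x <= 0] has
    [x_i > 0], and [p = x^T] works since [p K = - (K x)^T]; or [e_i = - l1 + l2 K] with
    [l1, l2 >= 0], and [p = l2] works since [p K = e_i + l1]. The sum of these solutions over [i]
    works for all indices at once. *)
Lemma tucker_skew (R : realFieldType) (n : nat) (K : 'M[R]_n) : K^T = - K ->
  exists2 p : 'rV[R]_n, (forall i, 0 <= p 0 i /\ 0 <= (p *m K) 0 i)
    & forall i, 0 < p 0 i + (p *m K) 0 i.
Proof.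
move=> skewK.
have one i : exists p : 'rV[R]_n,
    (forall i, 0 <= p 0 i /\ 0 <= (p *m K) 0 i) /\ 0 < p 0 i + (p *m K) 0 i.
  have [//|noP] := pselect (exists p : 'rV[R]_n,
    (forall i, 0 <= p 0 i /\ 0 <= (p *m K) 0 i) /\ 0 < p 0 i + (p *m K) 0 i).
  have [x Hx|l l0] := @farkas R (n + n) n (col_mx (- 1%:M) K) (delta_mx 0 i).
    rewrite -rowE mxE leNgt; apply/negP => xi; apply: noP; exists x^T.
    have Hx0 j : 0 <= x^T 0 j /\ 0 <= (x^T *m K) 0 j.
      split.
        have := Hx (lshift n j).
        by rewrite mul_col_mx col_mxEu mulNmx mul1mx !mxE oppr_le0.
      have := Hx (rshift n j); rewrite mul_col_mx col_mxEd => Kxj.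
      by rewrite -(trmxK K) -trmx_mul mxE skewK mulNmx mxE oppr_ge0.
    by split=> //; apply: ltr_pwDl; [rewrite mxE|case: (Hx0 i)].
  rewrite -[l]hsubmxK mul_row_col mulmxN mulmx1 => lE.
  have lK : rsubmx l *m K = delta_mx 0 i + lsubmx l.
    by rewrite lE [RHS]addrC addrA subrr add0r.
  exists (rsubmx l); split=> [j|]; rewrite lK !mxE.
    by split=> //; rewrite addr_ge0// ler0n.
  by rewrite !eqxx ltr_wpDl// ltr_pwDl.
have [p Hp] := choice one.
exists (\sum_i p i) => i; rewrite mulmx_suml !summxE.
  by split; apply: sumr_ge0 => j _; have [] := (Hp j).1 i.
rewrite -big_split/= (bigD1 i)//= ltr_pwDl ?(Hp i).2// sumr_ge0// => j _.
by have [? ?] := (Hp j).1 i; rewrite addr_ge0.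
Qed.

(** * Treeplexes are polytopes *)

Definition convexly_closed (R : realType) (n : nat) (Z : set 'rV[R]_n) :=
  forall (k : nat) (p : 'rV[R]_k) (C : 'M[R]_(k, n)),
  simplex p -> (forall i, Z (row i C)) -> Z (p *m C).

(* The points [c i] are indexed by [nat], with no condition beyond [K], so that
   polytopes of a dependent family can share a common number of generators. *)
Definition generated_by (R : realType) (n : nat) (Z : set 'rV[R]_n) (K : nat)
    (c : nat -> 'rV[R]_n) :=
  (forall i, Z (c i)) /\ forall z, Z z -> exists p : nat -> R,
    [/\ forall i, 0 <= p i, \sum_(i < K) p i = 1
      & z = \sum_(i < K) p i *: c i].

(** The two conjuncts together say that [Z] is the convex hull of finitely many points; nonemptiness
    is included because [c] is total. *)
Definition polytope (R : realType) (n : nat) (Z : set 'rV[R]_n) :=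
  convexly_closed Z /\ exists K c, generated_by Z K c.

Definition in_unit_cube (R : realType) (n : nat) (Z : set 'rV[R]_n) :=
  forall z, Z z -> forall i, 0 <= z 0 i <= 1.

Section Polytopes.
Variable R : realType.

Lemma polytope_nonempty n (Z : set 'rV[R]_n) : polytope Z -> Z !=set0.
Proof. by move=> [_ [K [c [Zc _]]]]; exists (c 0%N). Qed.

Lemma generated_by_widen n (Z : set 'rV[R]_n) K L c : (K <= L)%N ->
  generated_by Z K c -> generated_by Z L c.
Proof.
move=> KL [Zc gen]; split=> // z /gen [p [p0 p1 ->]].
exists (fun i => if (i < K)%N then p i else 0); split.
- by move=> i; case: ifP.
- by rewrite -p1 (big_ord_widen _ _ KL) [RHS]big_mkcond.
rewrite (big_ord_widen L (fun i => p i *: c i) KL) [LHS]big_mkcond.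
by apply: eq_bigr => i _; case: ifP => //; rewrite scale0r.
Qed.

Lemma sum_enum_val (V : nmodType) (I : finType) (F : I -> V) :
  \sum_i F i = \sum_(i < #|I|) F (enum_val i).
Proof. by rewrite -(big_enum_val F); apply: eq_bigl => i; rewrite inE. Qed.

Lemma generated_by_finType n (Z : set 'rV[R]_n) (I : finType) (c : I -> 'rV[R]_n) :
  Z !=set0 -> (forall i, Z (c i)) ->
  (forall z, Z z -> exists p : I -> R,
    [/\ forall i, 0 <= p i, \sum_i p i = 1 & z = \sum_i p i *: c i]) ->
  exists K c', generated_by Z K c'.
Proof.
move=> [z0 Zz0] Zc gen.
(* Indices beyond [#|I|] receive the default point [z0] and weight 0. *)
pose o i : option 'I_#|I| := insub i.
have oE (i : 'I_#|I|) : o i = Some i by rewrite /o valK.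
exists #|I|, (fun i => oapp (fun x => c (enum_val x)) z0 (o i)); split.
  by move=> i; case: (o i) => /=.
move=> z /gen [p [p0 p1 ->]].
exists (fun i => oapp (fun x => p (enum_val x)) 0 (o i)); split.
- by move=> i; case: (o i) => /=.
- by rewrite -p1 [RHS]sum_enum_val; apply: eq_bigr => i _; rewrite oE.
by rewrite [LHS]sum_enum_val; apply: eq_bigr => i _; rewrite oE.
Qed.

Lemma polytope_matrix n (Z : set 'rV[R]_n) : polytope Z ->
  exists K (C : 'M[R]_(K, n)), (forall i, Z (row i C)) /\
    forall z, Z z -> exists2 p, simplex p & z = p *m C.
Proof.
move=> [_ [K [c [Zc gen]]]]; exists K, (\matrix_(i < K) c i); split.
  by move=> i; rewrite rowK.
move=> z /gen [p [p0 p1 ->]]; exists (\row_i p i).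
  by split=> [i|]; [rewrite mxE|under eq_bigr do rewrite mxE].
by rewrite mulmx_sum_row; apply: eq_bigr => i _; rewrite rowK mxE.
Qed.

Lemma simplex_mulmx m n (p : 'rV[R]_m) (C : 'M[R]_(m, n)) :
  simplex p -> (forall i, simplex (row i C)) -> simplex (p *m C).
Proof.
move=> [p0 p1] HC; split=> [j|].
  rewrite mxE sumr_ge0// => i _; rewrite mulr_ge0//.
  by have := (HC i).1 j; rewrite mxE.
under eq_bigr do rewrite mxE.
rewrite exchange_big -[RHS]p1; apply: eq_bigr => i _ /=.
rewrite -mulr_sumr -[RHS]mulr1; congr (_ * _).
by rewrite -[RHS](HC i).2; apply: eq_bigr => j _; rewrite mxE.
Qed.

Lemma simplex_delta n (i : 'I_n) : simplex (delta_mx 0 i : 'rV[R]_n).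
Proof.
split=> [j|]; first by rewrite mxE ler0n.
rewrite (bigD1 i)//= big1 ?addr0 => [|j ji]; first by rewrite mxE !eqxx.
by rewrite mxE (negbTE ji).
Qed.

Lemma polytope_simplex n : polytope (@simplex R n.+1).
Proof.
split=> [k p C|]; first exact: simplex_mulmx.
apply: (@generated_by_finType _ _ 'I_n.+1 (fun i => delta_mx 0 i)).
- by exists (delta_mx 0 0); exact: simplex_delta.
- exact: simplex_delta.
- by move=> z [z0 z1]; exists (z 0); split=> //; exact: row_sum_delta.
Qed.

Lemma polytope_prod k (d : 'I_k -> nat) (Z : forall j, set 'rV[R]_(d j)) :
  (forall j, polytope (Z j)) ->
  polytope [set z : 'rV[R]_(\sum_j d j)%N | forall j, Z j (submxrow z j)].
Proof.
move=> HZ; split.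
  move=> m p C ps HC j; rewrite -mul_submxrow; apply: (HZ j).1 => // i.
  suff -> : row i (submxrow C j) = submxrow (row i C) j by exact: HC.
  by apply/rowP => l; rewrite !mxE.
have [K HK] := choice (fun j => (HZ j).2).
have [c Hc] : exists c : forall j, nat -> 'rV[R]_(d j),
    forall j, generated_by (Z j) (K j) (c j).
  exists (fun j => projT1 (cid (HK j))) => j; exact: projT2 (cid (HK j)).
pose L := (\max_j K j)%N.
have {}Hc j : generated_by (Z j) L (c j).
  exact: generated_by_widen (leq_bigmax j) (Hc j).
(* One generator for each choice of a generator in every factor; its weight is the product of the
   chosen weights. *)
pose cf (f : {ffun 'I_k -> 'I_L}) : 'rV[R]_(\sum_j d j)%N := \mxrow_j c j (f j).
apply: (@generated_by_finType _ _ _ cf).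
- by exists (\mxrow_j c j 0%N) => j; rewrite mxrowK; exact: (Hc j).1.
- by move=> f j; rewrite mxrowK; exact: (Hc j).1.
move=> z Zz.
have [p Hp] := choice (fun j => (Hc j).2 _ (Zz j)).
exists (fun f : {ffun 'I_k -> 'I_L} => \prod_j p j (f j)); split.
- by move=> f; apply: prodr_ge0 => j _; case: (Hp j).
- rewrite -(bigA_distr_bigA (fun j (i : 'I_L) => p j i)) big1// => j _.
  by case: (Hp j).
apply/mxrowP => j; rewrite submxrow_sum; apply/rowP => l.
rewrite summxE; have [_ _ ->] := Hp j; rewrite summxE.
(* The sum of [g h] is the wanted coordinate for [h = j] and 1 otherwise; distributing the product
   of these sums yields the sum over all [f]. *)
pose g (h : 'I_k) (i : 'I_L) := p h i * (if h == j then c j i 0 l else 1).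
transitivity (\prod_h \sum_i g h i).
  rewrite (bigD1 j)//= [X in _ * X]big1 ?mulr1 => [|h hj].
    by apply: eq_bigr => i _; rewrite /g eqxx mxE.
  rewrite -[RHS](_ : \sum_(i < L) p h i = 1); last by case: (Hp h).
  by apply: eq_bigr => i _; rewrite /g (negbTE hj) mulr1.
rewrite bigA_distr_bigA; apply: eq_bigr => f _.
rewrite big_split/=; have -> : submxrow ((\prod_h p h (f h)) *: cf f) j
    = (\prod_h p h (f h)) *: c j (f j).
  by rewrite -[in RHS](mxrowK (fun h => c h (f h)) j); apply/rowP => i; rewrite !mxE.
rewrite mxE; congr (_ * _).
by rewrite -big_mkcond big_pred1_eq.
Qed.

(* [h = 1] gives binary products, [h u = u 0 i] the third treeplex rule. *)
Lemma polytope_branch m n (Z1 : set 'rV[R]_m) (Z2 : set 'rV[R]_n)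
    (h : 'rV[R]_m -> R) :
  (forall k p (C : 'M[R]_(k, m)), simplex p ->
    h (p *m C) = \sum_i p 0 i * h (row i C)) ->
  (forall u, Z1 u -> 0 <= h u) ->
  polytope Z1 -> polytope Z2 ->
  polytope [set row_mx u (h u *: v) | u in Z1 & v in Z2].
Proof.
move=> hA h0 P1 P2; split.
  move=> k p C ps HC.
  have uv i : exists u, Z1 u /\ exists v, Z2 v /\ row_mx u (h u *: v) = row i C.
    by have [u Z1u [v Z2v <-]] := HC i; exists u; split=> //; exists v.
  have [u Hu] := choice uv.
  have [v Hv] := choice (fun i => (Hu i).2).
  pose U := \matrix_i u i; pose V := \matrix_i v i.
  have rU i : row i U = u i by rewrite rowK.
  exists (p *m U); first by apply: P1.1 => // i; rewrite rU; case: (Hu i).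
  have lC : lsubmx C = U.
    apply/row_matrixP => i; rewrite rU -[RHS](row_mxKl _ (h (u i) *: v i)).
    by rewrite (Hv i).2; apply/rowP => j; rewrite !mxE.
  have rC : rsubmx C = \matrix_i (h (u i) *: v i).
    apply/row_matrixP => i; rewrite rowK -[RHS](row_mxKr (u i)).
    by rewrite (Hv i).2; apply/rowP => j; rewrite !mxE.
  have hU := hA _ _ U ps.
  have t0 i : 0 <= p 0 i * h (row i U).
    by rewrite mulr_ge0// ?ps.1// rU h0//; case: (Hu i).
  (* If the scale is 0, every [p 0 i * h (u i)] vanishes, so the second block is 0 and any [v]
     serves. *)
  have [hU0|hU0] := eqVneq (h (p *m U)) 0.
    have [v0 Z2v0] := polytope_nonempty P2; exists v0 => //.
    rewrite hU0 scale0r -[RHS]hsubmxK -!mulmx_lsub -!mulmx_rsub lC rC.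
    congr row_mx; rewrite mulmx_sum_row big1// => i _.
    move: hU0; rewrite hU => /eqP; rewrite psumr_eq0// => /allP/(_ i).
    by rewrite mem_index_enum rU => /(_ isT)/eqP pi0; rewrite rowK scalerA pi0 scale0r.
  (* Otherwise the [v i] are averaged with weights [p 0 i * h (u i)], normalized by their sum
     [h (p *m U)]. *)
  exists ((\row_i ((h (p *m U))^-1 * (p 0 i * h (u i)))) *m V).
    apply: P2.1 => [|i]; last by rewrite rowK; case: (Hv i).
    split=> [i|]; first by rewrite mxE mulr_ge0 ?invr_ge0 -?rU// hU sumr_ge0.
    under eq_bigr do rewrite mxE -rU.
    by rewrite -mulr_sumr -hU mulVf.
  rewrite -[RHS]hsubmxK -!mulmx_lsub -!mulmx_rsub lC rC; congr row_mx.
  rewrite !mulmx_sum_row scaler_sumr; apply: eq_bigr => i _.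
  by rewrite !rowK mxE !scalerA -mulmx_sum_row mulVKf//.
have [_ [K1 [a [Z1a gen1]]]] := P1; have [_ [K2 [b [Z2b gen2]]]] := P2.
pose c (x : 'I_K1 * 'I_K2) : 'rV[R]_(m + n) := row_mx (a x.1) (h (a x.1) *: b x.2).
apply: (@generated_by_finType _ _ ('I_K1 * 'I_K2)%type c).
- by exists (row_mx (a 0%N) (h (a 0%N) *: b 0%N)); exists (a 0%N) => //; exists (b 0%N).
- by move=> x; exists (a x.1) => //; exists (b x.2).
move=> _ [u /gen1 [p [p0 p1 ->]] [v /gen2 [q [q0 q1 ->]] <-]].
exists (fun x : 'I_K1 * 'I_K2 => p x.1 * q x.2); split.
- by move=> x; rewrite mulr_ge0.
- rewrite -(pair_bigA _ (fun (i : 'I_K1) (j : 'I_K2) => p i * q j))/= -[RHS]p1.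
  by apply: eq_bigr => i _; rewrite -mulr_sumr q1 mulr1.
have hu : h (\sum_(i < K1) p i *: a i) = \sum_(i < K1) p i * h (a i).
  rewrite (_ : \sum_(i < K1) _ = (\row_i p i) *m (\matrix_(i < K1) a i)); last first.
    by rewrite mulmx_sum_row; apply: eq_bigr => i _; rewrite rowK mxE.
  rewrite hA; first by apply: eq_bigr => i _; rewrite rowK mxE.
  by split=> [i|]; [rewrite mxE|under eq_bigr do rewrite mxE].
apply/rowP => l; rewrite summxE hu.
rewrite -(pair_bigA _ (fun (i : 'I_K1) (j : 'I_K2) =>
  ((p i * q j) *: c (i, j)) 0 l))/=.
rewrite [LHS]mxE; under [RHS]eq_bigr do under eq_bigr do rewrite mxE [X in _ * X]mxE.
case: (fintype.split l) => j /=.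
  rewrite summxE; apply: eq_bigr => i _; rewrite mxE -mulr_suml -mulr_sumr.
  by rewrite q1 mulr1.
rewrite mxE summxE big_distrlr; apply: eq_bigr => i _; apply: eq_bigr => k _ /=.
by rewrite !mxE; ring.
Qed.

End Polytopes.

(** From here on a treeplex enters only as a polytope in the unit cube. Branching stays in the cube
    because it multiplies two numbers of [0, 1]. *)
Lemma treeplex_polytope (R : realType) (n : nat) (Z : set 'rV[R]_n) :
  treeplex Z -> in_unit_cube Z /\ polytope Z.
Proof.
elim=> {n Z} [n|k d Z _ IH|m n Z1 Z2 i _ [U1 P1] _ [U2 P2]].
- split; last exact: polytope_simplex.
  move=> z [z0 z1] i; rewrite z0 -z1 (bigD1 i)//= lerDl sumr_ge0//.
- split; last by apply: polytope_prod => j; case: (IH j).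
  move=> z Zz i; have := (IH (tagnat.sig1 i)).1 _ (Zz (tagnat.sig1 i)) (tagnat.sig2 i).
  by rewrite !mxE tagnat.sig2K.
split.
  move=> _ [u Z1u [v Z2v <-]] j; rewrite mxE.
  case: (fintype.split j) => k; first exact: U1.
  have /andP[u0 u1] := U1 _ Z1u i; have /andP[v0 v1] := U2 _ Z2v k.
  by rewrite mxE mulr_ge0//= mulr_ile1.
apply: (@polytope_branch _ _ _ _ _ (fun u => u 0 i)) => //.
  by move=> k p C _; rewrite mxE; apply: eq_bigr => j _; rewrite !mxE.
by move=> u /U1/(_ i)/andP[].
Qed.

Lemma profiles_polytope (R : realType) (M N : nat) (X : set 'rV[R]_M)
    (Y : set 'rV[R]_N) :
  polytope X -> polytope Y -> polytope (profiles X Y).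
Proof.
move=> PX PY.
have := @polytope_branch R M N X Y (fun=> 1).
under eq_fun do under eq_fun do rewrite scale1r.
apply=> // k p C [_ p1]; by under eq_bigr do rewrite mulr1.
Qed.

(** * Error bound at a unique equilibrium *)

Section Dot.
Variables (R : realType) (n : nat).
Implicit Types u v w : 'rV[R]_n.

Lemma dotE u v : dot u v = (u *m v^T) 0 0.
Proof. by rewrite mxE; apply: eq_bigr => i _; rewrite mxE. Qed.

Lemma dotC u v : dot u v = dot v u.
Proof. by apply: eq_bigr => i _; rewrite mulrC. Qed.

Lemma dotDl u v w : dot (u + v) w = dot u w + dot v w.
Proof. by rewrite !dotE mulmxDl mxE. Qed.

Lemma dotNl u w : dot (- u) w = - dot u w.
Proof. by rewrite !dotE mulNmx mxE. Qed.

Lemma dotBl u v w : dot (u - v) w = dot u w - dot v w.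
Proof. by rewrite dotDl dotNl. Qed.

Lemma dotZl a u w : dot (a *: u) w = a * dot u w.
Proof. by rewrite !dotE -scalemxAl mxE. Qed.

Lemma dotDr u v w : dot u (v + w) = dot u v + dot u w.
Proof. by rewrite dotC dotDl !(dotC _ u). Qed.

Lemma dotBr u v w : dot u (v - w) = dot u v - dot u w.
Proof. by rewrite dotC dotBl !(dotC _ u). Qed.

Lemma dotZr a u w : dot u (a *: w) = a * dot u w.
Proof. by rewrite dotC dotZl dotC. Qed.

End Dot.

Lemma dot_mulmx (R : realType) (m n : nat) (u : 'rV[R]_n) (v : 'rV[R]_m)
    (A : 'M[R]_(m, n)) :
  dot u (v *m A) = dot (u *m A^T) v.
Proof. by rewrite !dotE trmx_mul mulmxA. Qed.

Lemma dot_skew (R : realType) (n : nat) (S : 'M[R]_n) (u v : 'rV[R]_n) :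
  S^T = - S -> dot u (v *m S) = - dot v (u *m S).
Proof. by move=> skewS; rewrite dot_mulmx skewS mulmxN dotNl dotC. Qed.

Lemma dot_skew_diag (R : realType) (n : nat) (S : 'M[R]_n) (u : 'rV[R]_n) :
  S^T = - S -> dot u (u *m S) = 0.
Proof. by move/(dot_skew u u) => ?; lra. Qed.

(** With [s] the sum of the ratios [|b i| / |r i|], the step [1 / (1 + s)] satisfies
    [e * |b i| <= r i] whenever [r i > 0]. *)
Lemma finite_small_step (R : realFieldType) (I : finType) (r b : I -> R) :
  exists2 e : R, 0 < e <= 1 & forall i, 0 < r i -> 0 <= r i + e * b i.
Proof.
pose s := \sum_i `|b i| / `|r i|.
have t0 i : 0 <= `|b i| / `|r i| by rewrite divr_ge0.
have s0 : 0 <= s by apply: sumr_ge0.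
exists (1 + s)^-1; first by rewrite invr_gt0 invf_le1; lra.
move=> i ri0; have : `|b i| / `|r i| <= s by rewrite /s (bigD1 i)//= lerDl sumr_ge0.
rewrite (gtr0_norm ri0) ler_pdivrMr// => bi.
rewrite -(pmulr_rge0 _ (_ : 0 < 1 + s)); last by lra.
rewrite mulrDr mulVKf; last by rewrite gt_eqF//; lra.
have := ler_norm (- b i); rewrite normrN; lra.
Qed.

Lemma pos_sum_eq0 (R : realFieldType) k (p : 'rV[R]_k) :
  (forall i, 0 <= p 0 i) -> \sum_i p 0 i = 0 -> p = 0.
Proof.
move=> p0 /eqP; rewrite psumr_eq0// => /allP p00; apply/rowP => i; rewrite mxE.
by have /eqP := p00 i (mem_index_enum _).
Qed.

Lemma normalized_simplex (R : realType) k (p : 'rV[R]_k) :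
  (forall i, 0 <= p 0 i) -> 0 < \sum_i p 0 i ->
  simplex ((\sum_i p 0 i)^-1 *: p).
Proof.
move=> p0 ps; split=> [i|]; first by rewrite mxE mulr_ge0// invr_ge0 ltW.
by under eq_bigr do rewrite mxE; rewrite -mulr_sumr mulVf// gt_eqF.
Qed.

Lemma dot_combination (R : realType) (k n : nat) (p : 'rV[R]_k)
    (C : 'M[R]_(k, n)) (v : 'rV[R]_n) :
  dot (p *m C) v = \sum_i p 0 i * dot (row i C) v.
Proof.
rewrite -[C in LHS]trmxK -dot_mulmx; apply: eq_bigr => i _; congr (_ * _).
by rewrite mxE; apply: eq_bigr => j _; rewrite !mxE mulrC.
Qed.

Section SymmetricGame.
Variables (R : realType) (n : nat) (S : 'M[R]_n) (Z : set 'rV[R]_n).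
Variable zs : 'rV[R]_n.
Hypothesis skewS : S^T = - S.
Hypothesis polyZ : polytope Z.
Hypothesis Z_ge0 : forall z, Z z -> forall i, 0 <= z 0 i.
Hypothesis uniq_eq : forall z, Z z ->
  (forall w, Z w -> 0 <= dot w (z *m S)) -> z = zs.

(** Tucker's theorem is applied to the payoffs [C S C^T] between generators. Its normalized solution
    is an equilibrium, hence [zs]; existence of an equilibrium is thus obtained here, [uniq_eq]
    giving uniqueness alone. *)
Lemma equilibrium_vertices : exists K (C : 'M[R]_(K, n)),
  [/\ forall p, simplex p -> Z (p *m C),
      forall z, Z z -> exists2 p, simplex p & z = p *m C
    & exists p : 'rV[R]_K, [/\ simplex p, zs = p *m C &
        forall k, 0 < p 0 k /\ dot (row k C) (zs *m S) = 0 \/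
                  p 0 k = 0 /\ 0 < dot (row k C) (zs *m S)]].
Proof.
have [K [C [ZC gen]]] := polytope_matrix polyZ; exists K, C.
have cvx p : simplex p -> Z (p *m C) by move=> ps; apply: polyZ.1.
split=> //.
pose M := C *m S *m C^T.
have skewM : M^T = - M.
  by rewrite /M trmx_mul trmx_mul trmxK skewS mulNmx mulmxN mulmxA.
have [p p0 pK] := tucker_skew skewM.
have ME q k : (q *m M) 0 k = dot (row k C) (q *m C *m S).
  rewrite /M !mulmxA mxE; apply: eq_bigr => j _.
  by rewrite mulrC; congr (_ * _); rewrite !mxE.
(* If [p] were 0, strict positivity of [p + p M] would fail at any index, and there is one since [Z]
   is nonempty. *)
have sp : 0 < \sum_i p 0 i.
  rewrite lt_neqAle sumr_ge0 ?andbT => [|i _]; last by case: (p0 i).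
  apply/eqP => /esym/pos_sum_eq0 -/(_ (fun i => (p0 i).1)) p_0.
  have [z0 /gen [q [_ q1] _]] := polytope_nonempty polyZ.
  suff : \sum_i q 0 i = 0 by rewrite q1; lra.
  rewrite big1// => i _; have := pK i.
  by rewrite p_0 mul0mx mxE addr0 ltxx.
pose q := (\sum_i p 0 i)^-1 *: p.
have sq : simplex q by apply: normalized_simplex => // i; case: (p0 i).
have qM k : (q *m M) 0 k = (\sum_i p 0 i)^-1 * (p *m M) 0 k.
  by rewrite -scalemxAl mxE.
have zsE : zs = q *m C.
  apply/esym/uniq_eq => [|w /gen [r [r0 _] ->]]; first exact: cvx.
  rewrite dot_combination sumr_ge0// => k _.
  by rewrite mulr_ge0// -ME qM mulr_ge0 ?invr_ge0 ?(ltW sp)//; case: (p0 k).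
exists q; split=> // k; rewrite zsE -ME qM mxE.
(* By skewness this sum of nonnegative terms vanishes, so at each [k] one factor is 0; Tucker's
   strict inequality makes the other positive. *)
have : \sum_k p 0 k * (p *m M) 0 k = 0 by exact: (@dot_skew_diag R K M p).
move/eqP; rewrite psumr_eq0 => [/allP|i _]; last by apply: mulr_ge0; case: (p0 i).
move=> /(_ k (mem_index_enum _)) /= /eqP pk0.
have [pk|pk] := ltP 0 (p 0 k).
  left; rewrite mulr_gt0 ?invr_gt0//; split=> //.
  by move/eqP: pk0; rewrite mulf_eq0 gt_eqF//= => /eqP ->; rewrite mulr0.
have {}pk : p 0 k = 0 by apply/le_anti; rewrite pk; case: (p0 k).
right; rewrite pk mulr0; split=> //; have := pK k.
by rewrite pk add0r => ?; rewrite mulr_gt0 ?invr_gt0.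
Qed.

Lemma equilibrium_mem : Z zs.
Proof. by have [K [C [cvx _ [p [ps -> _]]]]] := equilibrium_vertices; exact: cvx. Qed.

Lemma equilibrium_ge0 w : Z w -> 0 <= dot w (zs *m S).
Proof.
have [K [C [_ gen [p [_ _ zsC]]]]] := equilibrium_vertices.
move=> /gen [q [q0 _] ->].
rewrite dot_combination sumr_ge0// => k _; rewrite mulr_ge0//.
by case: (zsC k) => -[_]; [move=> ->|exact: ltW].
Qed.

(* Strict complementarity at [zs] makes every direction that does not increase
   the gap against the face of [zs] lead to another equilibrium; by Farkas'
   lemma, each coordinate of [z - zs] is then dominated by those gaps. *)
Lemma equilibrium_error_bound : exists2 C0 : R, 0 <= C0 &
  forall z (U : R), Z z ->
  (forall w, Z w -> (forall i, zs 0 i = 0 -> w 0 i = 0) ->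
     - dot w (z *m S) <= U) ->
  forall i, `|z 0 i - zs 0 i| <= C0 * U.
Proof.
have [K [C [cvx gen [p [ps zsp zsC]]]]] := equilibrium_vertices.
have Zrow k : Z (row k C) by rewrite rowE; apply: cvx; exact: simplex_delta.
pose D : 'M[R]_(K, n) := \matrix_(k, j) (C k j - zs 0 j).
have DE (q : 'rV[R]_K) : q *m D = q *m C - (\sum_k q 0 k) *: zs.
  apply/rowP => j; rewrite !mxE mulr_suml -sumrB; apply: eq_bigr => k _.
  by rewrite mxE mulrBr.
pose E := C *m S^T *m D^T.
have EE (x : 'cV[R]_K) k : (E *m x) k 0 = dot (row k C) (x^T *m D *m S).
  by rewrite dotE !trmx_mul trmxK !mulmxA -!row_mul [RHS]mxE.
(* Only the generators carrying weight in [zs] are kept: [A2 x <= 0] says that moving along [x^T D]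
   does not lower their payoff, which is 0 at [zs]. *)
pose A2 : 'M[R]_K := \matrix_(k, i) (if 0 < p 0 k then - E k i else 0).
have A2E (x : 'cV[R]_K) k : (A2 *m x) k 0 =
    if 0 < p 0 k then - dot (row k C) (x^T *m D *m S) else 0.
  rewrite mxE; under eq_bigr do rewrite mxE.
  case: ifP => _; last by rewrite big1// => i _; rewrite mul0r.
  by rewrite -EE mxE -sumrN; apply: eq_bigr => i _; rewrite mulNr.
have dir0 (x : 'cV[R]_K) : (forall i, 0 <= x i 0) ->
    (forall k, (A2 *m x) k 0 <= 0) -> x^T *m D = 0.
  move=> x0 Ax0; have xT0 i : 0 <= x^T 0 i by rewrite mxE.
  have [s0|s0] := eqVneq (\sum_i x^T 0 i) 0.
    by rewrite (pos_sum_eq0 xT0 s0) mul0mx.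
  have {}s0 : 0 < \sum_i x^T 0 i by rewrite lt_neqAle eq_sym s0 sumr_ge0.
  have sq := normalized_simplex xT0 s0; set q := _ *: _ in sq.
  have qD : q *m D = (\sum_i x^T 0 i)^-1 *: (x^T *m D) by rewrite -scalemxAl.
  (* Generators in the support keep a nonnegative payoff; the others start from a positive one,
     which survives a step of size [e]. So the moved point is an equilibrium, and uniqueness kills
     the direction. *)
  have [e /andP[e0 e1] He] := finite_small_step
    (fun k => dot (row k C) (zs *m S)) (fun k => dot (row k C) (q *m D *m S)).
  suff /eqP : zs + e *: (q *m D) = zs.
    rewrite -subr_eq0 addrAC subrr add0r qD !scaler_eq0 invr_eq0.
    by rewrite !gt_eqF//= => /eqP.
  apply: uniq_eq.
    have -> : zs + e *: (q *m D) = ((1 - e) *: p + e *: q) *m C.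
      rewrite DE sq.2 scale1r mulmxDl -!scalemxAl -zsp scalerBl scale1r scalerBr.
      by rewrite addrA addrAC.
    apply: cvx; split=> [i|].
      rewrite mxE [X in X + _]mxE [X in _ + X]mxE.
      by rewrite addr_ge0 ?mulr_ge0 ?subr_ge0 ?(ltW e0) ?ps.1 ?sq.1.
    under eq_bigr => i _ do rewrite mxE [X in X + _]mxE [X in _ + X]mxE.
    by rewrite big_split/= -!mulr_sumr ps.2 sq.2; ring.
  move=> _ /gen [t [t0 _] ->]; rewrite dot_combination sumr_ge0// => k _.
  rewrite mulr_ge0// mulmxDl -scalemxAl dotDr dotZr.
  have [[pk ->]|[_ /He//]] := zsC k.
  rewrite add0r mulr_ge0 ?(ltW e0)// qD -scalemxAl dotZr.
  rewrite mulr_ge0 ?invr_ge0 ?(ltW s0)//.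
  by have := Ax0 k; rewrite A2E pk oppr_le0.
have U_ge0 z U : Z z -> (forall w, Z w -> (forall i, zs 0 i = 0 -> w 0 i = 0) ->
    - dot w (z *m S) <= U) -> 0 <= U.
  move=> Zz /(_ zs equilibrium_mem (fun i => id)); apply: le_trans.
  by rewrite dot_skew// opprK; exact: equilibrium_ge0.
have face k : 0 < p 0 k -> forall i, zs 0 i = 0 -> (row k C) 0 i = 0.
  move=> pk i; rewrite zsp mxE => /eqP; rewrite psumr_eq0 => [|j _]; last first.
    by rewrite mulr_ge0// ?ps.1//; have := Z_ge0 (Zrow j) i; rewrite mxE.
  move=> /allP /(_ k (mem_index_enum _)); rewrite mulf_eq0 gt_eqF//= mxE.
  by move/eqP.
have one (mb : 'I_n * bool) : exists c, 0 <= c /\ forall z (U : R), Z z ->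
    (forall w, Z w -> (forall i, zs 0 i = 0 -> w 0 i = 0) -> - dot w (z *m S) <= U) ->
    (-1) ^+ mb.2 * (z 0 mb.1 - zs 0 mb.1) <= c * U.
  case: mb => m b /=; pose c := (-1) ^+ b *: (col m D)^T.
  have cE (x : 'cV[R]_K) : (c *m x) 0 0 = (-1) ^+ b * (x^T *m D) 0 m.
    rewrite -scalemxAl mxE; congr (_ * _); rewrite !mxE.
    by apply: eq_bigr => i _; rewrite !mxE mulrC.
  (* By [dir0] the functional [c] vanishes on the cone [x >= 0], [A2 x <= 0], so it equals
     [- l1 + l2 A2] with [l1, l2 >= 0]. At the weights of [z] the first term is at most 0 and the
     second at most [U] times the sum of [l2]. *)
  have [x Hx|l l0 lE] := @farkas R (K + K) K (col_mx (- 1%:M) A2) c.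
    rewrite cE dir0 => [|i|k]; first by rewrite mxE mulr0.
      have := Hx (lshift K i).
      by rewrite mul_col_mx col_mxEu mulNmx mul1mx mxE oppr_le0.
    by have := Hx (rshift K k); rewrite mul_col_mx col_mxEd.
  have l1_ge0 i : 0 <= lsubmx l 0 i by rewrite mxE.
  have l2_ge0 i : 0 <= rsubmx l 0 i by rewrite mxE.
  move: lE; rewrite -[l]hsubmxK mul_row_col mulmxN mulmx1.
  move: (lsubmx l) (rsubmx l) l1_ge0 l2_ge0 => l1 l2 l1_ge0 l2_ge0 lE.
  exists (\sum_i l2 0 i); split=> [|z U Zz HU]; first exact: sumr_ge0.
  have [q [q0 q1] zq] := gen _ Zz.
  have dE : z - zs = q *m D by rewrite DE q1 scale1r zq.
  have -> : z 0 m - zs 0 m = (z - zs) 0 m by rewrite !mxE.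
  rewrite dE -[q]trmxK -cE lE mulmxDl mulNmx -mulmxA mxE -[leRHS]add0r lerD//.
    by rewrite mxE oppr_le0 mxE sumr_ge0// => i _; rewrite mulr_ge0// mxE.
  rewrite mxE mulr_suml ler_sum// => k _; rewrite ler_wpM2l//.
  rewrite A2E trmxK -dE; case: ifP => [pk|_]; last exact: (U_ge0 _ _ Zz HU).
  have [[_ k0]|[pk0]] := zsC k; last by rewrite pk0 ltxx in pk.
  rewrite mulmxBl dotBr k0 subr0; apply: HU => //; exact: face.
have [c Hc] := choice one.
exists (\sum_m (c (m, true) + c (m, false))) => [|z U Zz HU i].
  apply: sumr_ge0 => m _; rewrite addr_ge0//.
    by case: (Hc (m, true)).
  by case: (Hc (m, false)).
have U0 := U_ge0 _ _ Zz HU.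
have [ct0 /(_ _ _ Zz HU) /= ct] := Hc (i, true).
have [cf0 /(_ _ _ Zz HU) /= cf] := Hc (i, false).
have : (c (i, true) + c (i, false)) * U <= (\sum_m (c (m, true) + c (m, false))) * U.
  rewrite ler_wpM2r// [leRHS](bigD1 i)//= lerDl sumr_ge0// => m _.
  by rewrite addr_ge0//; case: (Hc (m, true)); case: (Hc (m, false)).
have := mulr_ge0 ct0 U0; have := mulr_ge0 cf0 U0.
move: ct cf; rewrite expr0 expr1 mulN1r mul1r mulrDl ler_norml; lra.
Qed.

End SymmetricGame.

(** * Entropic divergence and proximal steps *)

Section ScalarDivergence.
Variable R : realType.
Implicit Types a b c : R.

Lemma ln_div_le a b : 0 < a -> 0 < b -> ln a - ln b <= (a - b) / b.
Proof.
move=> a0 b0; have ab0 : 0 < a / b by rewrite divr_gt0.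
rewrite -ln_div ?posrE//; have -> : a / b = 1 + (a - b) / b by field; rewrite gt_eqF.
by apply: le_ln1Dx; rewrite mulrBl divff ?gt_eqF//; lra.
Qed.

Lemma ln_dist_le a b d : 0 < d -> d <= a -> d <= b -> `|ln a - ln b| <= `|a - b| / d.
Proof.
move=> d0 da db; have [a0 b0] := (lt_le_trans d0 da, lt_le_trans d0 db).
have bnd c x : 0 < c -> d <= c -> x / c <= `|x| / d.
  move=> c0 dc; apply: (@le_trans _ _ (`|x| / c)).
    by rewrite ler_wpM2r ?invr_ge0 ?(ltW c0) ?ler_norm.
  by rewrite ler_wpM2l// lef_pV2 ?posrE.
rewrite ler_norml lerNl opprB (le_trans (ln_div_le a0 b0))/= ?bnd// andbT.
by rewrite (le_trans (ln_div_le b0 a0))// distrC bnd.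
Qed.

Lemma divergence_ge0 a b : 0 <= a -> 0 < b -> 0 <= a * ln (a / b) - a + b.
Proof.
rewrite le0r => /orP[/eqP ->|a0] b0; first by rewrite mul0r; lra.
have := ler_wpM2l (ltW a0) (ln_div_le b0 a0).
rewrite ln_div ?posrE// mulrCA mulfV ?gt_eqF//; lra.
Qed.

Lemma divergence_le_sqr a b : 0 <= a -> 0 < b ->
  a * ln (a / b) - a + b <= (a - b) ^+ 2 / b.
Proof.
rewrite le0r => /orP[/eqP ->|a0] b0.
  by rewrite mul0r subr0 add0r sub0r sqrrN expr2 mulfK ?gt_eqF.
have := ler_wpM2l (ltW a0) (ln_div_le a0 b0).
rewrite ln_div ?posrE// (_ : (a - b) ^+ 2 / b = a * ((a - b) / b) - a + b); first lra.
by field; rewrite gt_eqF.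
Qed.

(** Strong convexity of the entropy on the unit interval: [ln] has slope at least 1 there, so the
    derivative [df] of the difference has the sign of [x - b], and the mean value theorem applies on
    either side of [b]. *)
Lemma divergence_ge_sqr a b : 0 <= a <= 1 -> 0 < b <= 1 ->
  (a - b) ^+ 2 / 2 <= a * ln (a / b) - a + b.
Proof.
move=> /andP[]; rewrite le0r => /orP[/eqP -> _ /andP[b0 b1]|a0 a1 /andP[b0 b1]].
  by rewrite mul0r; nra.
pose f := (@idfun R * (@ln R - cst (ln b)) - @idfun R) -
   (2^-1 *: ((@idfun R - cst b) * (@idfun R - cst b))).
pose df (x : R) := ln x - ln b - (x - b).
have fE x : f x = x * (ln x - ln b) - x - (x - b) ^+ 2 / 2.
  by rewrite /f !fctE /GRing.scale /= [2^-1 * _]mulrC.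
have fd : forall y : R, 0 < y -> is_derive y (1 : R) f (df y).
  move=> x x0.
  have dl := is_derive1_ln x0.
  apply: is_derive_eq; rewrite /df !fctE /GRing.scale /=.
  by field; rewrite gt_eqF.
have fc s t : 0 < s -> {within `[s, t], continuous f}.
  move=> s0; apply: derivable_within_continuous => x; rewrite in_itv/= => /andP[sx _].
  by apply: ex_derive; apply: fd; exact: lt_le_trans sx.
rewrite ln_div ?posrE//; suff : f b <= f a by rewrite !fE; lra.
have [ab|ba|->//] := ltgtP a b.
  have [||c] := @MVT _ f df a b ab; last first.
  - rewrite in_itv/= => /andP[ac cb] fE'.
    suff : df c <= 0 by nra.
    have c0 := lt_trans a0 ac.
    have := ln_div_le c0 b0; rewrite /df.
    have : (b - c) <= (b - c) / b by rewrite ler_peMr ?invf_ge1 //; lra.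
    lra.
  - exact: fc.
  - by move=> x; rewrite in_itv/= => /andP[ax _]; apply: fd; exact: lt_trans ax.
have [||c] := @MVT _ f df b a ba; last first.
- rewrite in_itv/= => /andP[bc ca] fE'.
  suff : 0 <= df c by nra.
  have c0 := lt_trans b0 bc.
  have := ln_div_le b0 c0; rewrite /df.
  have : (c - b) <= (c - b) / c by rewrite ler_peMr ?invf_ge1 //; lra.
  lra.
- exact: fc.
- by move=> x; rewrite in_itv/= => /andP[bx _]; apply: fd; exact: lt_trans bx.
Qed.

(** Dropping [b > 0] leaves [a * ln (a / b) <= c + a]. This keeps the iterates away from 0 on the
    support of the equilibrium. *)
Lemma divergence_ge_ln a b c : 0 < a -> 0 < b ->
  a * ln (a / b) - a + b <= c -> expR (ln a - (c + a) / a) <= b.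
Proof.
move=> a0 b0 abc; rewrite -[leRHS]lnK ?posrE// ler_expR.
rewrite lerBlDr -lerBlDl ler_pdivlMr//; move: abc; rewrite ln_div ?posrE//; lra.
Qed.

End ScalarDivergence.

Section VectorDivergence.
Variables (R : realType) (n : nat).
Implicit Types u w a z : 'rV[R]_n.

Lemma breg_van_ge_sqr u w : (forall i, 0 <= u 0 i <= 1) ->
  (forall i, 0 < w 0 i <= 1) -> dot (u - w) (u - w) / 2 <= breg_van u w.
Proof.
move=> u01 w01; rewrite mulr_suml; apply: ler_sum => i _.
by rewrite -expr2 !mxE; exact: divergence_ge_sqr.
Qed.

Lemma breg_van_le_sqr u w : (forall i, 0 <= u 0 i) -> (forall i, 0 < w 0 i) ->
  breg_van u w <= \sum_i (u 0 i - w 0 i) ^+ 2 / w 0 i.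
Proof. by move=> u0 w0; apply: ler_sum => i _; exact: divergence_le_sqr. Qed.

Lemma breg_van_ge0 u w : (forall i, 0 <= u 0 i) -> (forall i, 0 < w 0 i) ->
  0 <= breg_van u w.
Proof. by move=> u0 w0; apply: sumr_ge0 => i _; exact: divergence_ge0. Qed.

Lemma breg_van_three_points u w a : (forall i, 0 <= u 0 i) ->
  (forall i, 0 < w 0 i) -> (forall i, 0 < a 0 i) ->
  breg_van u a = breg_van u w + breg_van w a
    + dot (u - w) (map_mx (@ln R) w - map_mx (@ln R) a).
Proof.
move=> u0 w0 a0; rewrite -!big_split/=; apply: eq_bigr => i _.
have := u0 i; rewrite !mxE [ln (w 0 i / a 0 i)]ln_div ?posrE//.
rewrite le0r => /orP[/eqP ->|ui0]; first by rewrite !mul0r; ring.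
by rewrite !ln_div ?posrE//; ring.
Qed.

Lemma convexly_closed_segment (Z : set 'rV[R]_n) u w (s : R) :
  convexly_closed Z -> Z u -> Z w -> 0 <= s <= 1 -> Z (w + s *: (u - w)).
Proof.
move=> cvx Zu Zw /andP[s0 s1].
have -> : w + s *: (u - w) = row_mx s%:M (1 - s)%:M *m col_mx u w.
  rewrite mul_row_col !mul_scalar_mx scalerBl scale1r scalerBr addrC -!addrA.
  by congr (_ + _); rewrite addrC.
apply: cvx => [|i]; last first.
  have row0 (v : 'rV[R]_n) : row 0 v = v by apply/rowP => k; rewrite mxE.
  rewrite -[i]splitK; case: (fintype.split i) => j; rewrite ord1 /=.
    by rewrite rowKu row0.
  by rewrite rowKd row0.
split=> [i|].
  by rewrite mxE; case: (fintype.split i) => j; rewrite !mxE !ord1 ?mulr1n ?subr_ge0.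
by rewrite big_split_ord !big_ord1 row_mxEl row_mxEr !mxE /= addrC subrK.
Qed.

End VectorDivergence.

Section Prox.
Variables (R : realType) (n : nat) (Z : set 'rV[R]_n) (eta : R) (g a w : 'rV[R]_n).
Hypothesis cvxZ : convexly_closed Z.
Hypothesis Z_ge0 : forall z, Z z -> forall i, 0 <= z 0 i.
Hypothesis a_gt0 : forall i, 0 < a 0 i.
Hypothesis argmin_w : argmin Z (fun w => eta * dot w g + breg_van w a) w.

(* The slope of [x ln x] at [0] is [-oo]. *)
Lemma prox_gt0 u : Z u -> (forall i, 0 < u 0 i) -> forall i, 0 < w 0 i.
Proof.
move=> Zu u0; have [Zw minw] := argmin_w.
move=> k; rewrite lt0r Z_ge0// andbT; apply/eqP => wk0.
pose lnv := map_mx (@ln R) : 'rV_n -> 'rV_n.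
(* [s] is chosen so that [u 0 k * ln s = - (|K| + 1)]: the slope of the objective at [ws] towards
   [u] is then at most [K - |K| - 1 < 0], against minimality of [w]. *)
pose K := eta * dot (u - w) g - dot (u - w) (lnv a) + dot (u - w) (lnv u).
pose s := expR (- ((`|K| + 1) / u 0 k)).
have s0 : 0 < s := expR_gt0 _.
have s1 : s <= 1.
  by rewrite -expR0 ler_expR oppr_le0 divr_ge0 ?(ltW (u0 _))// addr_ge0.
have Zs := convexly_closed_segment cvxZ Zu Zw (_ : 0 <= s <= 1).
pose ws := w + s *: (u - w).
have wsE i : ws 0 i = (1 - s) * w 0 i + s * u 0 i by rewrite !mxE; ring.
have ws0 i : 0 < ws 0 i.
  by rewrite wsE ltr_wpDl ?mulr_gt0// mulr_ge0 ?subr_ge0 ?Z_ge0.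
have {Zs} Zs : Z ws by apply: Zs; rewrite ltW.
have dw : w - ws = - s *: (u - w) by rewrite opprD addNKr scaleNr.
have := minw _ Zs.
rewrite (breg_van_three_points (Z_ge0 Zw) ws0 a_gt0) dw dotZl.
have := breg_van_ge0 (Z_ge0 Zw) ws0.
rewrite [dot ws g]dotDl dotZl dotBr -/lnv => D0 minws.
have : 0 <= s * (eta * dot (u - w) g + dot (u - w) (lnv ws)
    - dot (u - w) (lnv a)) by lra.
rewrite pmulr_rge0// => {D0 minws}.
(* Off [k], [ws] lies between [w] and [u], so replacing [ln ws] by [ln u] can only increase the
   term; at [k], [ws] equals [s * u 0 k]. *)
have : dot (u - w) (lnv ws) <= dot (u - w) (lnv u) + u 0 k * ln s.
  rewrite [leRHS](_ : _ = \sum_i ((u - w) 0 i * lnv u 0 i +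
      if i == k then u 0 k * ln s else 0)); last first.
    by rewrite big_split/= -big_mkcond big_pred1_eq.
  apply: ler_sum => i _.
  rewrite ![(u - w) 0 i]mxE ![lnv _ _ _]mxE ![(- _ : 'rV_n) 0 i]mxE.
  case: eqP => [->|_].
    by rewrite wsE wk0 mulr0 add0r lnM ?posrE//; lra.
  rewrite addr0 -subr_ge0 -mulrBr.
  have [uw|wu] := leP (u 0 i) (w 0 i).
    rewrite mulr_le0 ?subr_le0// ler_ln ?posrE// wsE; nra.
  rewrite mulr_ge0 ?subr_ge0 ?(ltW wu)// ler_ln ?posrE// wsE; nra.
rewrite expRK mulrN mulrC divfK ?gt_eqF//.
have := ler_norm K; rewrite /K; lra.
Qed.

Hypothesis w_gt0 : forall i, 0 < w 0 i.

(** No derivative is taken: a step [s] towards [u] changes the objective by at most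
    [s * (A + s * K)], and if [A < 0] the chosen [s] gives [s * K <= - A / 2], hence a decrease. *)
Lemma prox_first_order u : Z u ->
  0 <= eta * dot (u - w) g + dot (u - w) (map_mx (@ln R) w - map_mx (@ln R) a).
Proof.
move=> Zu; have [Zw minw] := argmin_w; set A := (X in 0 <= X).
rewrite leNgt; apply/negP => A0.
pose K := \sum_i (u 0 i - w 0 i) ^+ 2 / w 0 i.
have K0 : 0 <= K by apply: sumr_ge0 => i _; rewrite divr_ge0 ?sqr_ge0// ltW.
have KA : 0 < 2 * (K - A) by lra.
pose s := - A / (2 * (K - A)).
have s0 : 0 < s by rewrite divr_gt0; lra.
have s1 : s <= 1 by rewrite ler_pdivrMr//; lra.
have Zs : Z (w + s *: (u - w)) by apply: convexly_closed_segment; rewrite ?(ltW s0).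
have := minw _ Zs.
rewrite (breg_van_three_points (Z_ge0 Zs) w_gt0 a_gt0).
have := breg_van_le_sqr (Z_ge0 Zs) w_gt0.
rewrite [X in _ <= X -> _](_ : _ = s ^+ 2 * K); last first.
  by rewrite mulr_sumr; apply: eq_bigr => i _; rewrite !mxE; ring.
have -> : w + s *: (u - w) - w = s *: (u - w) by rewrite addrAC subrr add0r.
rewrite dotZl [dot (w + _) g]dotDl dotZl => DK minws.
have : 0 <= s * (A + s * K) by rewrite /A; lra.
rewrite pmulr_rge0//.
have : s * K <= - A / 2; last by lra.
rewrite /s mulrAC ler_pdivrMr//; nra.
Qed.

Lemma prox_three_points u : Z u ->
  eta * dot (w - u) g <= breg_van u a - breg_van u w - breg_van w a.
Proof.
move=> Zu; have := prox_first_order Zu.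
rewrite (breg_van_three_points (Z_ge0 Zu) w_gt0 a_gt0) !dotBl; lra.
Qed.

End Prox.

(** * Convergence of the iterates *)

(** If the bound failed at the next index, [v = C / (n + 1)] would satisfy [v ^ 2 < k * (x - v)]
    with [x * n <= C = v * (n + 1)], so [v * n < k]. But [C >= 2 * k] and [n >= 1] give
    [v * n >= k]. *)
Lemma inverse_rate (R : realFieldType) (k T : R) (th : nat -> R) :
  0 < k -> 0 <= T -> th 1%N <= T ->
  (forall t, (1 <= t)%N -> th t.+1 ^+ 2 <= k * (th t - th t.+1)) ->
  forall t, (1 <= t)%N -> th t <= (T + 2 * k) / t%:R.
Proof.
move=> k0 T0 th1 rec; elim=> // t IHt _.
case: t IHt => [_|t IHt]; first by rewrite divr1; lra.
have {}IHt := IHt isT; have := rec t.+1 isT.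
move: IHt; set x := th t.+1; set y := th t.+2; set C := T + 2 * k.
have n0 : 1 <= t.+1%:R :> R by rewrite ler1n.
rewrite -[t.+2]addn1 natrD; move: n0; set n := t.+1%:R : R.
move=> n1 xC yr; rewrite leNgt; apply/negP => Cy.
have C0 : 2 * k <= C by rewrite /C; lra.
set v := C / (n + 1%:R) in Cy.
have vE : v * (n + 1) = C by rewrite /v divfK// gt_eqF//; lra.
have xn : x * n <= C by move: xC; rewrite ler_pdivlMr//; lra.
have v0 : 0 < v by rewrite divr_gt0; lra.
have vy : v ^+ 2 < y ^+ 2 by rewrite ltr_pXn2r// nnegrE; lra.
have h : v ^+ 2 < k * (x - v) by nra.
have : v ^+ 2 * n < k * v.
  have : v ^+ 2 * n < k * (x - v) * n by rewrite ltr_pM2r//; lra.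
  have : k * (x * n) <= k * C by rewrite ler_pM2l.
  by rewrite -vE; lra.
have : v * n < k by nra.
nra.
Qed.

Section Step.
Variables (R : realType) (n : nat) (S : 'M[R]_n) (Z : set 'rV[R]_n).
Variables (zs : 'rV[R]_n) (eta : R).
Hypothesis skewS : S^T = - S.
Hypothesis S_le1 : forall i j, `|S i j| <= 1.
Hypothesis polyZ : polytope Z.
Hypothesis Z01 : in_unit_cube Z.
Hypothesis uniq_eq : forall z, Z z ->
  (forall w, Z w -> 0 <= dot w (z *m S)) -> z = zs.
Hypothesis eta_gt0 : 0 < eta.
Hypothesis eta_le : eta * n%:R <= 1 / 8.

Let Z_ge0 z : Z z -> forall i, 0 <= z 0 i.
Proof. by move=> Zz i; have /andP[] := Z01 Zz i. Qed.

(** The bound on the step size is spent here: entrywise Young inequalities give the factor [n / 2],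
    and [eta * n <= 1 / 8]. *)
Lemma dot_mulmx_le_sqr (u v : 'rV[R]_n) :
  eta * dot u (v *m S) <= (dot u u + dot v v) / 16.
Proof.
have sqr_ge0 (x : 'rV[R]_n) : 0 <= dot x x.
  by apply: sumr_ge0 => i _; rewrite -expr2 sqr_ge0.
have h : dot u (v *m S) <= n%:R * ((dot u u + dot v v) / 2).
  have -> : n%:R * ((dot u u + dot v v) / 2) =
      \sum_i \sum_j (u 0 i * u 0 i + v 0 j * v 0 j) / 2.
    under eq_bigr do rewrite -mulr_suml big_split/= sumr_const card_ord.
    rewrite -mulr_suml big_split/= sumr_const card_ord sumrMnl.
    by rewrite -mulrnDl [LHS]mulr_natl mulrnAl.
  apply: ler_sum => i _; rewrite mxE mulr_sumr; apply: ler_sum => j _.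
  have := S_le1 j i; rewrite ler_norml => /andP[s1 s2].
  set x := u 0 i; set y := v 0 j; set s := S j i in s1 s2 *.
  have : 0 <= (1 - s) * (x + y) ^+ 2.
    by rewrite mulr_ge0 ?subr_ge0// exprn_even_ge0.
  have : 0 <= (1 + s) * (x - y) ^+ 2 by rewrite mulr_ge0 ?exprn_even_ge0//; lra.
  by rewrite !expr2; lra.
have := ler_wpM2l (ltW eta_gt0) h; move/le_trans; apply.
have := ler_wpM2r (addr_ge0 (sqr_ge0 u) (sqr_ge0 v)) eta_le; lra.
Qed.

(** One round of the algorithm: [l], [a], [m], [b] stand for z_(t-1), zh_t, z_t, zh_(t+1). *)
Variables (l a m b : 'rV[R]_n).
Hypotheses (Zl : Z l) (Za : Z a).
Hypotheses (l_gt0 : forall i, 0 < l 0 i) (a_gt0 : forall i, 0 < a 0 i).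
Hypothesis m_min : argmin Z (fun w => eta * dot w (l *m S) + breg_van w a) m.
Hypothesis b_min : argmin Z (fun w => eta * dot w (m *m S) + breg_van w a) b.

Let Zm : Z m := m_min.1.
Let Zb : Z b := b_min.1.
Let cvxZ := polyZ.1.
Let m_gt0 : forall i, 0 < m 0 i := prox_gt0 cvxZ Z_ge0 a_gt0 m_min Za a_gt0.
Let b_gt0 : forall i, 0 < b 0 i := prox_gt0 cvxZ Z_ge0 a_gt0 b_min Za a_gt0.
Let Zs : Z zs := equilibrium_mem skewS polyZ uniq_eq.

Let dist_le u w : Z u -> Z w -> (forall i, 0 < w 0 i) ->
  dot (u - w) (u - w) / 2 <= breg_van u w.
Proof.
move=> Zu Zw w0; apply: breg_van_ge_sqr; first exact: Z01.
by move=> i; rewrite w0; have /andP[] := Z01 Zw i.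
Qed.

(** Add the three-point inequalities for [b] against [zs] and for [m] against [b]. The equilibrium
    property makes [dot (m - zs) (m *m S)] nonnegative; the remaining cross term in [m - b] and
    [m - l] is absorbed by the divergences through their quadratic lower bounds. *)
Lemma step_descent :
  breg_van zs b + breg_van b m / 4 + (breg_van b m + breg_van m a) / 2
    <= breg_van zs a + breg_van a l / 4.
Proof.
have Hb := prox_three_points cvxZ Z_ge0 a_gt0 b_min b_gt0 Zs.
have Hm := prox_three_points cvxZ Z_ge0 a_gt0 m_min m_gt0 Zb.
have Hs : 0 <= dot (m - zs) (m *m S).
  rewrite dotBl dot_skew_diag// sub0r dot_skew// opprK.
  exact: equilibrium_ge0 skewS polyZ uniq_eq _ Zm.
have := dot_mulmx_le_sqr (m - b) (m - l).
have dbm := dist_le Zb Zm m_gt0; have dma := dist_le Zm Za a_gt0.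
have dal := dist_le Za Zl l_gt0.
have : dot (m - l) (m - l) <= 2 * dot (m - a) (m - a) + 2 * dot (a - l) (a - l).
  rewrite !mulr_sumr -big_split/=; apply: ler_sum => i _; rewrite !mxE.
  have := sqr_ge0 (m 0 i - a 0 i - (a 0 i - l 0 i)); rewrite expr2; lra.
have dotsym : dot (m - b) (m - b) = dot (b - m) (b - m).
  by apply: eq_bigr => i _; rewrite !mxE; ring.
have bm0 := breg_van_ge0 (Z_ge0 Zb) m_gt0.
have ma0 := breg_van_ge0 (Z_ge0 Zm) a_gt0.
have Hs' := mulr_ge0 (ltW eta_gt0) Hs.
have bzs : dot (b - zs) (m *m S) = dot (m - zs) (m *m S) - dot (m - b) (m *m S).
  by rewrite !dotBl; ring.
move: Hb Hm Hs' dbm; rewrite -dotsym bzs mulmxBl [dot _ (_ *m _ - _)]dotBr; lra.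
Qed.

(* The rate is governed by [d], a lower bound on the coordinates of the iterates
   in the support of [zs]; off that support the logarithms are controlled by
   comparing only with points [w] supported like [zs]. *)
Lemma step_error (C0 d s : R) : 0 <= C0 -> 0 < d <= 1 ->
  (forall z U, Z z ->
    (forall w, Z w -> (forall i, zs 0 i = 0 -> w 0 i = 0) ->
       - dot w (z *m S) <= U) ->
    forall i, `|z 0 i - zs 0 i| <= C0 * U) ->
  (forall i, 0 < zs 0 i -> d <= a 0 i /\ d <= b 0 i) ->
  (forall i, `|m 0 i - a 0 i| <= s) -> (forall i, `|m 0 i - b 0 i| <= s) ->
  breg_van zs b <= n%:R * C0 * (n%:R ^+ 2 + 2 * n%:R / (d * eta)) / d * s.
Proof.
move=> C00 /andP[d0 d1] err dab ma mb.
have ab i : `|a 0 i - b 0 i| <= 2 * s.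
  have := ler_normD (a 0 i - m 0 i) (m 0 i - b 0 i); rewrite addrA subrK.
  by rewrite [`|a 0 i - m 0 i|]distrC; have := ma i; have := mb i; lra.
pose U := (n%:R ^+ 2 + 2 * n%:R / (d * eta)) * s.
have HU w : Z w -> (forall i, zs 0 i = 0 -> w 0 i = 0) -> - dot w (b *m S) <= U.
  move=> Zw face.
  have wb i : `|w 0 i - b 0 i| <= 1.
    have /andP[? ?] := Z01 Zw i; have /andP[? ?] := Z01 Zb i.
    by rewrite ler_norml; lra.
  (* In this condition [m] is replaced by [b] at cost [h1] and the logarithms cost [h2]; as
     [dot b (b *m S) = 0], only the gap of [b] against [w] remains. *)
  have foc := prox_first_order cvxZ Z_ge0 a_gt0 b_min b_gt0 Zw.
  have h1 : dot (w - b) ((m - b) *m S) <= n%:R ^+ 2 * s.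
    rewrite expr2 -mulrA mulr_natl -[X in _ *+ X]card_ord -sumr_const.
    apply: ler_sum => i _; rewrite mulr_natl -[X in _ *+ X]card_ord -sumr_const.
    rewrite [X in _ * X <= _]mxE mulr_sumr; apply: ler_sum => j _.
    apply: le_trans (ler_norm _) _; rewrite !normrM -[leRHS]mul1r !mxE.
    by rewrite ler_pM ?mulr_ge0// -[leRHS]mulr1 ler_pM.
  have h2 : dot (w - b) (map_mx (@ln R) b - map_mx (@ln R) a) <= n%:R * (2 * s / d).
    rewrite mulr_natl -[X in _ *+ X]card_ord -sumr_const.
    apply: ler_sum => i _; rewrite !mxE.
    have s0 : 0 <= 2 * s := le_trans (normr_ge0 _) (ab i).
    have := Z_ge0 Zs i; rewrite le0r => /orP[/eqP zi|/dab[da db]].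
      (* Off the support [w 0 i = 0], and the term is [b 0 i * (ln (a 0 i) - ln (b 0 i)) <= a 0 i -
         b 0 i], with no lower bound on the coordinates. *)
      have := ln_div_le (a_gt0 i) (b_gt0 i); rewrite ler_pdivlMr// face//.
      have := ler_norm (a 0 i - b 0 i); have := ab i.
      have : 2 * s <= 2 * s / d by rewrite ler_peMr ?invf_ge1.
      lra.
    have := ln_dist_le d0 db da => lnd.
    apply: le_trans (ler_norm _) _; rewrite normrM -[leRHS]mul1r ler_pM//.
    by rewrite (le_trans lnd)// ler_wpM2r ?invr_ge0 ?(ltW d0)// distrC.
  have -> : U = n%:R ^+ 2 * s + n%:R * (2 * s / d) / eta.
    by rewrite /U; field; rewrite !gt_eqF.
  rewrite -(ler_pM2l eta_gt0) mulrDr [eta * (_ / eta)]mulrCA mulfV ?gt_eqF// mulr1.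
  have := ler_wpM2l (ltW eta_gt0) h1.
  have e1 : dot (w - b) (m *m S) = dot (w - b) ((m - b) *m S) + dot w (b *m S).
    by rewrite mulmxBl dotBr [dot (w - b) (b *m S)]dotBl dot_skew_diag// subr0 subrK.
  by move: foc; rewrite e1; lra.
have bz := err b U Zb HU.
have -> : n%:R * C0 * (n%:R ^+ 2 + 2 * n%:R / (d * eta)) / d * s = n%:R * (C0 * U / d).
  by rewrite /U; ring.
rewrite mulr_natl -[X in _ *+ X]card_ord -sumr_const; apply: ler_sum => i _.
(* Off the support the summand is just [b 0 i]; on it, the quadratic bound has denominator at least
   [d]. *)
have := Z_ge0 Zs i; rewrite le0r => /orP[/eqP zi|zi].
  have := bz i; rewrite zi subr0 gtr0_norm// mul0r subr0 add0r => /le_trans; apply.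
  by rewrite ler_peMr ?invf_ge1// (le_trans _ (bz i)).
apply: le_trans (divergence_le_sqr (ltW zi) (b_gt0 i)) _.
have [_ db] := dab i zi.
have nb : `|zs 0 i - b 0 i| <= 1.
  have /andP[? ?] := Z01 Zs i; have /andP[? ?] := Z01 Zb i.
  by rewrite ler_norml; lra.
rewrite ler_pM ?invr_ge0 ?sqr_ge0 ?(ltW (b_gt0 i)) ?lef_pV2 ?posrE//.
apply: le_trans (bz i); rewrite [leRHS]distrC -real_normK ?num_real// expr2.
by rewrite ler_piMl.
Qed.

(** All coordinate moves are at most the square root of [2 * zeta], so the squares of both parts of
    the new potential are linear in [zeta], while [step_descent] bounds [zeta / 2] by the
    decrease. *)
Lemma step_progress (C0 d T : R) : 0 <= C0 -> 0 < d <= 1 ->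
  (forall z U, Z z ->
    (forall w, Z w -> (forall i, zs 0 i = 0 -> w 0 i = 0) ->
       - dot w (z *m S) <= U) ->
    forall i, `|z 0 i - zs 0 i| <= C0 * U) ->
  (forall v, Z v -> (forall i, 0 < v 0 i) -> breg_van zs v <= T ->
     forall i, 0 < zs 0 i -> d <= v 0 i) ->
  breg_van zs a + breg_van a l / 4 <= T ->
  (breg_van zs b + breg_van b m / 4) ^+ 2 <=
    (8 * (n%:R * C0 * (n%:R ^+ 2 + 2 * n%:R / (d * eta)) / d) ^+ 2 + T + 1) *
    (breg_van zs a + breg_van a l / 4 - (breg_van zs b + breg_van b m / 4)).
Proof.
move=> C00 d01 err low HT; have desc := step_descent.
set K := n%:R * C0 * _ / d.
have bm0 := breg_van_ge0 (Z_ge0 Zb) m_gt0.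
have ma0 := breg_van_ge0 (Z_ge0 Zm) a_gt0.
have al0 := breg_van_ge0 (Z_ge0 Za) l_gt0.
have zb0 := breg_van_ge0 (Z_ge0 Zs) b_gt0.
have za0 := breg_van_ge0 (Z_ge0 Zs) a_gt0.
set zeta := breg_van b m + breg_van m a in desc.
have zeta0 : 0 <= zeta by rewrite addr_ge0.
have coord u w : dot (u - w) (u - w) / 2 <= zeta ->
    forall i, `|u 0 i - w 0 i| <= Num.sqrt (2 * zeta).
  move=> uw i; rewrite -[leLHS]sqrtr_sqr ler_sqrt ?mulr_ge0//.
  have : (u 0 i - w 0 i) ^+ 2 <= dot (u - w) (u - w).
    rewrite /dot (bigD1 i)//= !mxE -expr2 lerDl sumr_ge0// => j _.
    by rewrite -expr2 sqr_ge0.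
  lra.
have bK : breg_van zs b <= K * Num.sqrt (2 * zeta).
  apply: step_error => //.
  - by move=> i zi; split; apply: low => //; lra.
  - by apply: coord; have := dist_le Zm Za a_gt0; rewrite /zeta; lra.
  - move=> i; rewrite distrC; apply: coord.
    by have := dist_le Zb Zm m_gt0; rewrite /zeta; lra.
have bK2 : breg_van zs b ^+ 2 <= K ^+ 2 * (2 * zeta).
  rewrite -[2 * zeta in leRHS]sqr_sqrtr ?mulr_ge0// -exprMn.
  by rewrite lerXn2r// nnegrE// (le_trans zb0).
have bm2 : breg_van b m ^+ 2 <= zeta * (2 * T).
  by rewrite expr2 ler_pM//; rewrite /zeta in desc *; lra.
have := sqr_ge0 (breg_van zs b - breg_van b m / 4).
set th' := breg_van zs b + _ / 4; set th := breg_van zs a + _ / 4.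
have zth : zeta / 2 <= th - th' by rewrite /th /th'; lra.
have K0 : 0 <= 8 * K ^+ 2 + T + 1.
  have := sqr_ge0 K; rewrite /th in HT; lra.
have := ler_wpM2l K0 zth.
have := mulr_ge0 (sqr_ge0 K) zeta0.
have : 0 <= T * zeta by rewrite mulr_ge0//; lra.
rewrite /th' !expr2 in bK2 bm2 *; lra.
Qed.

End Step.

(** * The bilinear game as a skew-symmetric game *)

Lemma F_block (R : realType) (M N : nat) (G : 'M[R]_(M, N)) z :
  F G z = z *m block_mx 0 (- G) G^T 0.
Proof.
by rewrite -[z in RHS]hsubmxK mul_row_block !mulmx0 add0r addr0 mulmxN.
Qed.

Lemma dot_row_mx (R : realType) (M N : nat) (x x' : 'rV[R]_M) (y y' : 'rV[R]_N) :
  dot (row_mx x y) (row_mx x' y') = dot x x' + dot y y'.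
Proof.
rewrite /dot big_split_ord /=; congr (_ + _).
  by apply: eq_bigr => i _; rewrite !row_mxEl.
by apply: eq_bigr => i _; rewrite !row_mxEr.
Qed.

Lemma dot_F (R : realType) (M N : nat) (G : 'M[R]_(M, N)) x y x' y' :
  dot (row_mx x' y') (F G (row_mx x y)) = payoff G x' y - payoff G x y'.
Proof.
rewrite /F dot_row_mx row_mxKl row_mxKr; congr (_ + _).
by rewrite dotC dotNl dotC dot_mulmx dotC.
Qed.

Lemma profiles_unit_cube (R : realType) (M N : nat) (X : set 'rV[R]_M)
    (Y : set 'rV[R]_N) :
  in_unit_cube X -> in_unit_cube Y -> in_unit_cube (profiles X Y).
Proof.
move=> X01 Y01 _ [x Xx [y Yy <-]] i; rewrite mxE.
by case: (fintype.split i) => j; [exact: X01|exact: Y01].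
Qed.

Section SaddlePoint.
Variables (R : realType) (M N : nat) (X : set 'rV[R]_M) (Y : set 'rV[R]_N).
Variable G : 'M[R]_(M, N).
Hypothesis X01 : in_unit_cube X.
Hypothesis Y01 : in_unit_cube Y.

Lemma payoff_bounded x y : X x -> Y y ->
  `|payoff G x y| <= \sum_i \sum_j `|G i j|.
Proof.
move=> Xx Yy; apply: le_trans (ler_norm_sum _ _ _) _; apply: ler_sum => i _.
have /andP[x0 x1] := X01 Xx i; rewrite normrM ger0_norm// -[leRHS]mul1r ler_pM//.
rewrite mxE; apply: le_trans (ler_norm_sum _ _ _) _; apply: ler_sum => j _.
have /andP[y0 y1] := Y01 Yy j.
by rewrite normrM mxE ger0_norm// -[leRHS]mul1r ler_pM.
Qed.

(** Any [payoff G x' y] separates the value guaranteed by [x] from the supremum at [x'], and dually.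
    [payoff_bounded] ensures that the supremum and infimum really bound their sets. *)
Lemma saddle_point_nash x y : X x -> Y y ->
  (forall x' y', X x' -> Y y' -> payoff G x y' <= payoff G x' y) ->
  nash X Y G (row_mx x y).
Proof.
move=> Xx Yy saddle; exists x; last exists y => //; split=> //.
- move=> x' Xx'; apply: (@le_trans _ _ (payoff G x' y)).
    apply: ge_sup; first by exists (payoff G x y), y.
    by move=> _ [y' Yy' <-]; exact: saddle.
  apply: ub_le_sup; last by exists y.
  exists (\sum_i \sum_j `|G i j|) => _ [y' Yy' <-].
  by rewrite (le_trans (ler_norm _))// payoff_bounded.
move=> y' Yy'; apply: (@le_trans _ _ (payoff G x y')).
  apply: ge_inf; last by exists x.
  exists (- \sum_i \sum_j `|G i j|) => _ [x' Xx' <-].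
  by rewrite lerNl (le_trans (ler_norm _))// normrN payoff_bounded.
apply: lb_le_inf; first by exists (payoff G x y), x.
by move=> _ [x' Xx' <-]; exact: saddle.
Qed.

End SaddlePoint.

Theorem theorem6 (R : realType) (M N : nat)
    (X : set 'rV[R]_M) (Y : set 'rV[R]_N) (G : 'M[R]_(M, N))
    (HX : treeplex X) (HY : treeplex Y)
    (HG : forall i j, -1 <= G i j <= 1)
    (HF : forall z, profiles X Y z -> forall i, `|F G z 0 i| <= 1)
    (zs : 'rV[R]_(M + N)) (Hzs : nash X Y G = [set zs])
    (eta : R) (Heta0 : 0 < eta) (Heta : eta <= 1 / (8 * (M + N)%:R))
    (z1 : 'rV[R]_(M + N)) (Hz1 : profiles X Y z1)
    (Hz1_gt0 : forall i, 0 < z1 0 i) :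
  exists C2 : R, 0 < C2 /\
    forall z zh : nat -> 'rV[R]_(M + N),
      vomwu X Y G eta z1 z zh ->
      forall t : nat, (1 <= t)%N ->
        1 / 2 * enorm (zh t - zs) ^+ 2 <= breg_van zs (zh t) /\
        breg_van zs (zh t) <= C2 / t%:R.
Proof.
have [X01 polyX] := treeplex_polytope HX; have [Y01 polyY] := treeplex_polytope HY.
have polyZ := profiles_polytope polyX polyY.
have Z01 := profiles_unit_cube X01 Y01.
set Z := profiles X Y in Hz1 polyZ Z01 *.
have Z_ge0 z : Z z -> forall i, 0 <= z 0 i.
  by move=> Zz i; have /andP[] := Z01 z Zz i.
pose S : 'M[R]_(M + N) := block_mx 0 (- G) G^T 0.
have skewS : S^T = - S.
  by rewrite tr_block_mx opp_block_mx !trmx0 !oppr0 opprK linearN/= trmxK.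
have S_le1 i j : `|S i j| <= 1.
  rewrite /S mxE; case: (fintype.split i) => i'; rewrite mxE;
    case: (fintype.split j) => j'; rewrite !mxE ?normr0// ?normrN ler_norml; exact: HG.
have FS z : F G z = z *m S := F_block G z.
have uniq_eq z : Z z -> (forall w, Z w -> 0 <= dot w (z *m S)) -> z = zs.
  move=> [x Xx [y Yy <-]] Hw; suff : nash X Y G (row_mx x y) by rewrite Hzs.
  apply: saddle_point_nash => // x' y' Xx' Yy'.
  have := Hw (row_mx x' y'); rewrite -FS dot_F subr_ge0; apply.
  by exists x' => //; exists y'.
have eta_le : eta * (M + N)%:R <= 1 / 8.
  (* In dimension 0 the bound on [eta] would read [eta <= 0], since the inverse of 0 is 0. *)
  have P0 : 0 < (M + N)%:R :> R.
    rewrite ltr0n lt0n; apply/eqP => P0; move: Heta.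
    by rewrite P0 mulr0 invr0 mulr0 leNgt Heta0.
  move: Heta; rewrite !ler_pdivlMr//; first by lra.
  by rewrite mulr_gt0.
have Zzs := equilibrium_mem skewS polyZ uniq_eq.
have [C0 C00 err] := equilibrium_error_bound skewS polyZ Z_ge0 uniq_eq.
pose T := breg_van zs z1.
have T0 : 0 <= T by apply: breg_van_ge0 => //; exact: Z_ge0.
(* With [b = -1] the small step is a common lower bound [d <= 1] for these positive numbers. *)
have [d d01 Hd] := finite_small_step
  (fun i => expR (ln (zs 0 i) - (T + zs 0 i) / zs 0 i)) (fun=> -1).
have low v : Z v -> (forall i, 0 < v 0 i) -> breg_van zs v <= T ->
    forall i, 0 < zs 0 i -> d <= v 0 i.
  move=> Zv v0 vT i zi; apply: le_trans (@divergence_ge_ln _ _ _ T zi (v0 i) _).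
    by have := Hd i (expR_gt0 _); rewrite mulrN1 subr_ge0.
  apply: le_trans vT; rewrite [leRHS](bigD1 i)//= lerDl sumr_ge0// => j _.
  by apply: divergence_ge0 => //; exact: Z_ge0.
pose k := 8 * ((M + N)%:R * C0 *
    ((M + N)%:R ^+ 2 + 2 * (M + N)%:R / (d * eta)) / d) ^+ 2 + T + 1.
have k0 : 0 < k by rewrite ltr_wpDl// addr_ge0// mulr_ge0 ?sqr_ge0.
exists (T + 2 * k); split=> [|z zh [z0 zh1 step]]; first by rewrite ltr_wpDl// mulr_gt0.
have {}step t : (1 <= t)%N ->
    argmin Z (fun w => eta * dot w (z t.-1 *m S) + breg_van w (zh t)) (z t) /\
    argmin Z (fun w => eta * dot w (z t *m S) + breg_van w (zh t)) (zh t.+1).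
  by move=> /step; rewrite !FS.
(* The indices are offset because round [t] starts from z_(t-1) and zh_t, which coincide at [t = 1];
   hence [th 1] equals [T]. *)
have iterates t : (1 <= t)%N -> [/\ Z (z t.-1), Z (zh t), forall i, 0 < z t.-1 0 i
    & forall i, 0 < zh t 0 i].
  elim: t => // -[_ _|t IH _]; first by rewrite /= z0 zh1.
  have [_ Zh _ h0] := IH isT; have [minz minh] := step t.+1 isT.
  split; first exact: minz.1; first exact: minh.1.
    exact: (prox_gt0 polyZ.1 Z_ge0 h0 minz Zh h0).
  exact: (prox_gt0 polyZ.1 Z_ge0 h0 minh Zh h0).
pose th t := breg_van zs (zh t) + breg_van (zh t) (z t.-1) / 4.
have zz0 : breg_van z1 z1 = 0.
  by apply: big1 => i _; rewrite divff ?gt_eqF// ln1 mulr0; ring.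
have th1 : th 1%N = T by rewrite /th /= z0 zh1 zz0 mul0r addr0.
have descent t : (1 <= t)%N -> th t.+1 <= th t.
  move=> t1; have [Zl Za l0 a0] := iterates t t1; have [minz minh] := step t t1.
  have [Zm Zb m0 b0] := iterates t.+1 isT.
  have := step_descent skewS S_le1 polyZ Z01 uniq_eq Heta0 eta_le Zl Za l0 a0 minz minh.
  have := breg_van_ge0 (Z_ge0 _ Zb) m0; have := breg_van_ge0 (Z_ge0 _ Zm) a0.
  by rewrite /th /=; lra.
have thT t : (1 <= t)%N -> th t <= T.
  elim: t => // -[_ _|t IH _]; first by rewrite th1.
  by rewrite (le_trans (descent t.+1 isT))// IH.
have rec t : (1 <= t)%N -> th t.+1 ^+ 2 <= k * (th t - th t.+1).
  move=> t1; have [Zl Za l0 a0] := iterates t t1; have [minz minh] := step t t1.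
  exact: (step_progress skewS S_le1 polyZ Z01 uniq_eq Heta0 eta_le Zl Za l0 a0
    minz minh C00 d01 err low (thT t t1)).
move=> t t1; have [Zl Zt l0 t0] := iterates t t1; split.
  rewrite /enorm sqr_sqrtr; last by apply: sumr_ge0 => i _; rewrite -expr2 sqr_ge0.
  rewrite mulrC mul1r (_ : dot _ _ = dot (zs - zh t) (zs - zh t)); last first.
    by rewrite -opprB dotNl dotC dotNl opprK.
  apply: breg_van_ge_sqr => i; first exact: Z01.
  by rewrite t0; have /andP[] := Z01 _ Zt i.
have := inverse_rate k0 T0 (thT 1%N isT) rec t1; apply: le_trans.
by rewrite /th lerDl divr_ge0// breg_van_ge0//; exact: Z_ge0.
Qed.
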